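(* For every $q\in\mathbb{Z}$, the group $BS(1,q)$ admits a one-counter left-order, and $BS(1,q)$ admits a regular left-order if and only if $q\geq -1$. Moreover, for $q\geq 2$, every regular left-order on $BS(1,q)$ is induced by the affine action of $BS(1,q)$ on $\mathbb{R}$ given by $a\colon x\mapsto qx$, $b\colon x\mapsto x+1$.
   Context: For $q\neq 0$, $BS(1,q)=\langle a,b\mid aba^{-1}=b^q\rangle$; by convention $BS(1,0)=\mathbb{Z}$. A left-order on a group $G$ is a total order invariant under left multiplication, with positive cone $P=\{g: 1\prec g\}$. For a class of languages $\mathcal{C}$, a left-order on a finitely generated group is a $\mathcal{C}$-left-order if there is a finite set $X$, a surjective monoid homomorphism $\pi\colon X^*\to G$ and a language $\mathcal{L}\subseteq X^*$ in $\mathcal{C}$ with $\pi(\mathcal{L})=P$. ''Regular'' means $\mathcal{C}$ is the class of languages accepted by finite state automata; ''one-counter'' means $\mathcal{C}$ is the class of languages accepted by nondeterministic pushdown automata with a single stack symbol. The map $a\mapsto(x\mapsto qx)$, $b\mapsto(x\mapsto x+1)$ defines a faithful action $\rho$ of $BS(1,q)$ ($q\ge 2$) on $\mathbb{R}$ by increasing affine maps; a left-order $\prec$ is said to be induced by this action if there is a point $x\in\mathbb{R}$ such that either for all $g$ with $\rho(g)(x)\neq x$ one has $1\prec g\iff \rho(g)(x)>x$, or for all such $g$ one has $1\prec g\iff\rho(g)(x)<x$. *)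

(* Defs.v *)
From mathcomp Require Import all_boot.
From Stdlib Require Import ZArith Reals.
Set Implicit Arguments. Unset Strict Implicit. Unset Printing Implicit Defensive.

Record group := Group {
  gcar :> Type;
  gmul : gcar -> gcar -> gcar;
  gone : gcar;
  ginv : gcar -> gcar;
  gmulA : forall x y z, gmul x (gmul y z) = gmul (gmul x y) z;
  gmul1g : forall x, gmul gone x = x;
  gmulg1 : forall x, gmul x gone = x;
  gmulVg : forall x, gmul (ginv x) x = gone;
  gmulgV : forall x, gmul x (ginv x) = gone
}.
Arguments gmul {g}. Arguments gone {g}. Arguments ginv {g}.

Definition gpow (G : group) (g : G) (n : Z) : G :=
  match n with
  | Z0 => gone
  | Zpos p => Pos.iter (gmul g) gone p
  | Zneg p => ginv (Pos.iter (gmul g) gone p)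
  end.

Definition group_hom (G H : group) (f : G -> H) : Prop :=
  forall x y, f (gmul x y) = gmul (f x) (f y).

Definition generated_by (G : group) (a b : G) : Prop :=
  forall S : G -> Prop,
    S gone -> S a -> S b ->
    (forall x y, S x -> S y -> S (gmul x y)) ->
    (forall x, S x -> S (ginv x)) ->
    forall g, S g.

Definition bs_rel (q : Z) (G : group) (a b : G) : Prop :=
  gmul (gmul a b) (ginv a) = gpow b q.

(* (G, a, b) is a presentation of BS(1,q) = < a, b | a b a^-1 = b^q >:
   generated by a, b, the relation holds, and the universal property of the
   presentation holds.  For q = 0 this gives < a, b | b = 1 > = Z, matching
   the convention BS(1,0) = Z. *)
Definition BS_presentation (q : Z) (G : group) (a b : G) : Prop :=
  [/\ generated_by a b,
      bs_rel q a b &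
      forall (H : group) (h1 h2 : H), bs_rel q h1 h2 ->
        exists f : G -> H, [/\ group_hom f, f a = h1 & f b = h2]].

Definition left_order (G : group) (lt : G -> G -> Prop) : Prop :=
  [/\ forall x, ~ lt x x,
      forall x y z, lt x y -> lt y z -> lt x z,
      forall x y, x <> y -> lt x y \/ lt y x &
      forall g x y, lt x y -> lt (gmul g x) (gmul g y)].

Definition language (X : finType) := seq X -> Prop.

Definition eval_word (G : group) (X : Type) (pi : X -> G) (w : seq X) : G :=
  foldr (fun x acc => gmul (pi x) acc) gone w.

Definition lang_class := forall X : finType, language X -> Prop.

Record dfa (X : finType) := DFA {
  dstate : finType;
  dstart : dstate;
  dfinal : pred dstate;
  dtrans : dstate -> X -> dstate
}.
Definition dfa_accepts (X : finType) (A : dfa X) (w : seq X) : bool :=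
  @dfinal X A (foldl (@dtrans X A) (@dstart X A) w).
Definition regular : lang_class :=
  fun X L => exists A : dfa X, forall w, L w <-> dfa_accepts A w.

(* Nondeterministic pushdown automata with a single stack symbol (plus the
   bottom-of-stack marker), accepting by final state.  The stack is X^n ⊥ and
   is represented by the counter n.  A transition
     otrans s o z s' k
   reads o (a letter, or None = epsilon move), is enabled when the top of the
   stack is the bottom marker (z = true, i.e. n = 0) or the stack symbol
   (z = false, i.e. n > 0), moves to state s' and replaces the top symbol by
   k copies of the stack symbol (keeping the bottom marker if it was on top);
   push lengths are bounded by opmax. *)
Record oca (X : finType) := OCA {
  ostate : finType;
  ostart : ostate;
  ofinal : pred ostate;
  opmax : nat;
  otrans : ostate -> option X -> bool -> ostate -> 'I_opmax.+1 -> bool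
}.

Definition ocons (X : Type) (o : option X) (w : seq X) : seq X :=
  match o with Some x => x :: w | None => w end.

Inductive oca_run (X : finType) (A : oca X) :
    ostate A -> nat -> seq X -> ostate A -> nat -> Prop :=
  | oca_run_nil : forall s n, @oca_run X A s n [::] s n
  | oca_run_step : forall s n o s' (k : 'I_(opmax A).+1) w s'' n'',
      @otrans X A s o (n == 0) s' k ->
      @oca_run X A s' (if n == 0 then nat_of_ord k else n.-1 + k) w s'' n'' ->
      @oca_run X A s n (ocons o w) s'' n''.

Definition oca_accepts (X : finType) (A : oca X) (w : seq X) : Prop :=
  exists s n, @oca_run X A (@ostart X A) 0 w s n /\ @ofinal X A s.

Definition one_counter : lang_class :=
  fun X L => exists A : oca X, forall w, L w <-> oca_accepts A w.

Definition C_left_order (C : lang_class) (G : group) (lt : G -> G -> Prop) : Prop :=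
  exists (X : finType) (pi : X -> G) (L : language X),
    [/\ C X L,
        forall g : G, exists w, eval_word pi w = g &
        forall g : G, lt gone g <-> exists w, L w /\ eval_word pi w = g].

Definition action_on_R (G : group) (rho : G -> R -> R) : Prop :=
  forall g h x, rho (gmul g h) x = rho g (rho h x).

Definition induced_by_action (G : group) (rho : G -> R -> R)
    (lt : G -> G -> Prop) : Prop :=
  exists x : R,
    (forall g : G, rho g x <> x -> (lt gone g <-> Rlt x (rho g x))) \/
    (forall g : G, rho g x <> x -> (lt gone g <-> Rlt (rho g x) x)).

(* Main.v *)
Require Import Defs.
From mathcomp Require Import all_boot.
From Stdlib Require Import ZArith Reals Lia Lra Classical.

(** Elements of BS(1,q), q <> 0, are the affine maps x |-> q^m x + r, where r
    lies in Z[1/q].  Regular orders: a^+ for q = 0, the lexicographic order on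
    (m, r) for q = 1, -1, and the order of the orbit of the point 0 for
    q >= 2.  For every q <> 0 the lexicographic order is one-counter, since
    its positive cone is made of the elements a^(-2i) b^k a^(2i) a^j with
    j > 0, or j = 0 and k > 0.

    The converse rests on one obstruction.  If |q| >= 2 and all elements with
    m = 1 have the same sign, a cone language accepted by a finite automaton
    has, on its words with m = 0, prefixes with m bounded below; hence these
    words represent translations with bounded denominators, although up to
    inversion every translation by q^(-i) must be represented.  For q <= -2
    every left-order is of this kind, because conjugation by an element with
    m = 1 reverses the order of the translations.  For q >= 2, either a is
    comparable in the same way with all translations, and the obstruction
    applies, or a determines a Dedekind cut t of the translations, and the
    order is induced by the action at the point t / (q - 1). *)

Set Implicit Arguments. Unset Strict Implicit. Unset Printing Implicit Defensive.

(** * Groups and affine coordinates *)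

Section GroupBasics.
Context {G : group}.
Implicit Types x y z : G.

Lemma gmulKg x y : gmul (ginv x) (gmul x y) = y.
Proof. by rewrite gmulA gmulVg gmul1g. Qed.

Lemma gmulVKg x y : gmul x (gmul (ginv x) y) = y.
Proof. by rewrite gmulA gmulgV gmul1g. Qed.

Lemma gmulgI x y z : gmul x y = gmul x z -> y = z.
Proof. by move=> e; rewrite -(gmulKg x y) e gmulKg. Qed.

Lemma ginvK x : ginv (ginv x) = x.
Proof. by apply: (@gmulgI (ginv x)); rewrite gmulgV gmulVg. Qed.

Lemma ginv1 : ginv gone = gone :> G.
Proof. by rewrite -[RHS](gmulVg gone) gmulg1. Qed.

Lemma ginvM x y : ginv (gmul x y) = gmul (ginv y) (ginv x).
Proof.
by apply: (@gmulgI (gmul x y)); rewrite gmulgV -gmulA gmulVKg gmulgV.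
Qed.

Lemma gpow_succ x (n : Z) : gpow x (Z.succ n) = gmul x (gpow x n).
Proof.
(* A negative power is an inverse, and [ginvM] reverses the factors; commuting x with its powers
   repairs this. *)
have comm p : Pos.iter (gmul x) gone (Pos.succ p) = gmul (Pos.iter (gmul x) gone p) x.
  elim/Pos.peano_ind: p => [|p IH]; first by rewrite /= !gmulg1.
  by rewrite Pos.iter_succ {1}IH gmulA -Pos.iter_succ.
case: n => [|p|p] //; first by rewrite /= Pos.add_1_r Pos.iter_succ.
case: (Pos.succ_pred_or p) => [->|<-]; first by rewrite /= gmulg1 gmulgV.
have -> : Z.succ (Z.neg (Pos.succ (Pos.pred p))) = Z.neg (Pos.pred p) by lia.
by rewrite /gpow comm ginvM gmulVKg.
Qed.

Lemma gpow_add x (n k : Z) : gpow x (n + k) = gmul (gpow x n) (gpow x k).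
Proof.
elim/Z.peano_ind: n => [|n IH|n IH]; first by rewrite gmul1g.
  by rewrite Z.add_succ_l !gpow_succ IH gmulA.
apply: (@gmulgI x); rewrite gmulA -!gpow_succ Z.succ_pred -IH.
by congr gpow; lia.
Qed.

Lemma gpow1 x : gpow x 1 = x.
Proof. exact: gmulg1. Qed.

End GroupBasics.

Local Notation "q ^^ n" := (powerRZ (IZR q) n) (at level 30).

(** * The affine group receiving BS(1,q) *)

Section AffineGroup.
Variables (q : Z) (q0 : q <> 0%Z).

Lemma IZR_nz : IZR q <> 0%R. Proof. by move/eq_IZR. Qed.

Lemma powqD m n : q ^^ (m + n) = Rmult (q ^^ m) (q ^^ n).
Proof. exact: powerRZ_add IZR_nz. Qed.

Lemma powqVl m : Rmult (q ^^ (- m)) (q ^^ m) = 1%R.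
Proof. by rewrite -powqD Z.add_opp_diag_l. Qed.

(** Composition of the maps x |-> q^m x + r. The exponent m is stored rather than the slope q^m,
    which does not determine m when q is 1 or -1. *)
Definition aff_mul (x y : Z * R) : Z * R :=
  ((x.1 + y.1)%Z, (x.2 + q ^^ x.1 * y.2)%R).
Definition aff_inv (x : Z * R) : Z * R := ((- x.1)%Z, (- (q ^^ (- x.1) * x.2))%R).

Lemma aff_mulA x y z : aff_mul x (aff_mul y z) = aff_mul (aff_mul x y) z.
Proof. by rewrite /aff_mul /= powqD; f_equal; [lia|ring]. Qed.
Lemma aff_mul1g x : aff_mul (0%Z, 0%R) x = x.
Proof. by case: x => m r; rewrite /aff_mul /=; f_equal; ring. Qed.
Lemma aff_mulg1 x : aff_mul x (0%Z, 0%R) = x.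
Proof. by case: x => m r; rewrite /aff_mul /=; f_equal; [lia|ring]. Qed.
Lemma aff_mulVg x : aff_mul (aff_inv x) x = (0%Z, 0%R).
Proof. by rewrite /aff_mul /=; f_equal; [lia|ring]. Qed.
Lemma aff_mulgV x : aff_mul x (aff_inv x) = (0%Z, 0%R).
Proof.
rewrite /aff_mul /=; f_equal; first lia.
rewrite Ropp_mult_distr_r_reverse -Rmult_assoc -powqD Z.add_opp_diag_r /=.
ring.
Qed.

Definition aff_group : group :=
  @Defs.Group _ aff_mul (0%Z, 0%R) aff_inv
    aff_mulA aff_mul1g aff_mulg1 aff_mulVg aff_mulgV.

Lemma aff_translation_pow n : gpow ((0%Z, 1%R) : aff_group) n = (0%Z, IZR n).
Proof.
elim/Z.peano_ind: n => [//|n IH|n IH].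
  by rewrite gpow_succ IH /= /aff_mul /= succ_IZR; f_equal; ring.
apply: (@gmulgI aff_group (0%Z, 1%R)); rewrite -gpow_succ Z.succ_pred IH.
by rewrite /= /aff_mul /= -Z.sub_1_r minus_IZR; f_equal; ring.
Qed.

Lemma aff_bs_rel : bs_rel q ((1%Z, 0%R) : aff_group) ((0%Z, 1%R) : aff_group).
Proof.
rewrite /bs_rel aff_translation_pow /= /aff_mul /=.
by f_equal; ring.
Qed.

End AffineGroup.

(* [a^i g = b^k a^j] is the normal form [g = a^-i b^k a^j]; stated without
   inverses it is stable under products for every [q], even [q = 0]. *)
Lemma BS_normal_form (q : Z) (G : group) (a b : G) :
  BS_presentation q a b -> forall g : G, exists i j : nat, exists k : Z,
    gmul (gpow a (Z.of_nat i)) g = gmul (gpow b k) (gpow a (Z.of_nat j)).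
Proof.
move=> [gen rel _].
have ab k : gmul a (gpow b k) = gmul (gpow b (q * k)) a.
  have ab1 : gmul a b = gmul (gpow b q) a by rewrite -rel -gmulA gmulVg gmulg1.
  elim/Z.peano_ind: k => [|k IH|k IH].
  - by rewrite Z.mul_0_r /= gmulg1 gmul1g.
  - by rewrite gpow_succ gmulA ab1 -gmulA IH gmulA -gpow_add; congr (gmul (gpow _ _) _); lia.
  apply: (@gmulgI _ (gpow b q)); rewrite gmulA -ab1 -gmulA -gpow_succ Z.succ_pred IH.
  by rewrite gmulA -gpow_add; congr (gmul (gpow _ _) _); lia.
have apb n k : exists k', gmul (gpow a (Z.of_nat n)) (gpow b k) =
    gmul (gpow b k') (gpow a (Z.of_nat n)).
  elim: n k => [|n IH] k; first by exists k; rewrite /= gmulg1 gmul1g.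
  have [k' e] := IH k; exists (q * k')%Z.
  by rewrite Nat2Z.inj_succ gpow_succ -gmulA e gmulA ab gmulA.
apply: gen.
- by exists 0, 0, 0%Z.
- by exists 0, 1, 0%Z; rewrite gmul1g gmul1g gpow1.
- by exists 0, 0, 1%Z; rewrite gmul1g gmulg1 gpow1.
(* In a^(i'+i) x y, the factor a^i' moves past b^k and is swapped with a^j so as to meet y; then a^j
   moves past b^k'. *)
- move=> x y [i [j [k ex]]] [i' [j' [k' ey]]].
  have [l el] := apb i' k; have [l' el'] := apb j k'.
  exists (i' + i)%coq_nat, (j + j')%coq_nat, (l + l')%Z.
  rewrite !Nat2Z.inj_add !gpow_add -gmulA (gmulA (gpow a _) x) ex -!gmulA.
  rewrite (gmulA (gpow a _) (gpow b _)) el -!gmulA; congr gmul.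
  rewrite (gmulA _ _ y) -gpow_add Z.add_comm gpow_add -gmulA ey.
  by rewrite gmulA el' -gmulA.
move=> x [i [j [k e]]]; exists j, i, (- k)%Z.
apply: (@gmulgI _ (gpow b k)); rewrite gmulA -e -!gmulA gmulgV gmulg1.
by rewrite gmulA -gpow_add Z.add_opp_diag_r gmul1g.
Qed.

(* [g] acts on the line as [x |-> q^(m g) x + r g]. *)
Record affine_coords (q : Z) (G : group) (a b : G) (m : G -> Z) (r : G -> R)
    : Prop := AffineCoords {
  acM : forall g h, m (gmul g h) = (m g + m h)%Z;
  acRM : forall g h, r (gmul g h) = (r g + q ^^ (m g) * r h)%R;
  acMa : m a = 1%Z;
  acRa : r a = 0%R;
  acMb : m b = 0%Z;
  acRb : r b = 1%R;
  acI : forall g h, m g = m h -> r g = r h -> g = h;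
  acR : forall g, exists (i : nat) (k : Z), (q ^^ (Z.of_nat i) * r g)%R = IZR k
}.

Section Coords.
Variables (q : Z) (G : group) (m : G -> Z) (r : G -> R).
Variable q0 : q <> 0%Z.
Hypothesis mM : forall g h, m (gmul g h) = (m g + m h)%Z.
Hypothesis rM : forall g h, r (gmul g h) = (r g + q ^^ (m g) * r h)%R.

Lemma m_one : m gone = 0%Z.
Proof. by have := mM gone gone; rewrite gmulg1; lia. Qed.

Lemma r_one : r gone = 0%R.
Proof. by have := rM gone gone; rewrite gmulg1 m_one /=; lra. Qed.

Lemma m_inv g : m (ginv g) = (- m g)%Z.
Proof. by have := mM (ginv g) g; rewrite gmulVg m_one; lia. Qed.

Lemma r_inv g : r (ginv g) = (- (q ^^ (- m g) * r g))%R.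
Proof. by have := rM (ginv g) g; rewrite gmulVg r_one m_inv; lra. Qed.

Lemma m_pow g n : m (gpow g n) = (n * m g)%Z.
Proof.
elim/Z.peano_ind: n => [|n IH|n IH]; first by rewrite m_one.
  by rewrite gpow_succ mM IH; lia.
by have := mM g (gpow g (Z.pred n)); rewrite -gpow_succ Z.succ_pred IH; lia.
Qed.

Lemma r_pow0 g n : m g = 0%Z -> r (gpow g n) = (IZR n * r g)%R.
Proof.
move=> mg; elim/Z.peano_ind: n => [|n IH|n IH]; first by rewrite r_one; ring.
  by rewrite gpow_succ rM mg IH succ_IZR /=; ring.
have := rM g (gpow g (Z.pred n)); rewrite -gpow_succ Z.succ_pred IH mg /=.
by rewrite -Z.sub_1_r minus_IZR; lra.
Qed.

Lemma r_pow_fix g n : r g = 0%R -> r (gpow g n) = 0%R.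
Proof.
move=> rg; elim/Z.peano_ind: n => [|n IH|n IH]; first by rewrite r_one.
  by rewrite gpow_succ rM rg IH; ring.
have := rM g (gpow g (Z.pred n)); rewrite -gpow_succ Z.succ_pred IH rg => e.
have nz : q ^^ (m g) <> 0%R by apply: powerRZ_NOR; apply: IZR_nz.
by apply: (Rmult_eq_reg_l (q ^^ (m g))) => //; lra.
Qed.

End Coords.

(** The universal property gives a homomorphism to the affine group; injectivity and the
    denominators are read off the normal form. *)
Lemma BS_affine_coords (q : Z) (G : group) (a b : G) :
  BS_presentation q a b -> q <> 0%Z ->
  exists (m : G -> Z) (r : G -> R), affine_coords q a b m r.
Proof.
move=> HBS q0; have nf := BS_normal_form HBS.
case: HBS => gen rel /(_ (aff_group q0) (1%Z, 0%R) (0%Z, 1%R) (aff_bs_rel q0)).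
move=> [f [fM fa fb]].
pose m g := (f g).1; pose r g := (f g).2.
have mM g h : m (gmul g h) = (m g + m h)%Z by rewrite /m fM.
have rM g h : r (gmul g h) = (r g + q ^^ (m g) * r h)%R by rewrite /r fM.
have ma : m a = 1%Z by rewrite /m fa.
have ra : r a = 0%R by rewrite /r fa.
have mb : m b = 0%Z by rewrite /m fb.
have rb : r b = 1%R by rewrite /r fb.
have nfc g : exists i j : nat, exists k : Z,
    [/\ gmul (gpow a (Z.of_nat i)) g = gmul (gpow b k) (gpow a (Z.of_nat j)),
        (Z.of_nat i + m g)%Z = Z.of_nat j &
        (q ^^ (Z.of_nat i) * r g)%R = IZR k].
  have [i [j [k e]]] := nf g; exists i, j, k; split=> //.
    by have := f_equal m e; rewrite !mM !(m_pow mM) ma mb; lia.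
  have := f_equal r e; rewrite !rM !(m_pow mM) (r_pow0 mM rM k mb).
  by rewrite !(r_pow_fix q0 mM rM _ ra) ma mb rb Z.mul_1_r; lra.
exists m, r; split=> //; last by move=> g; have [i [j [k []]]] := nfc g; exists i, k.
move=> g h eqm eqr; apply: (@gmulgI _ (ginv g)); rewrite gmulVg.
set x := gmul _ h.
have mx : m x = 0%Z by rewrite mM (m_inv mM); lia.
have rx : r x = 0%R by rewrite rM (m_inv mM) (r_inv mM rM) eqr; ring.
(* In a^i x = b^k a^j the trivial coordinates of x force i = j and k = 0. *)
have [i [j [k []]]] := nfc x; rewrite mx rx Rmult_0_r Z.add_0_r => + /Nat2Z.inj ij.
move=> + /esym /(eq_IZR _ 0) k0; rewrite k0 -ij /= gmul1g => e.
by apply: (@gmulgI _ (gpow a (Z.of_nat i))); rewrite e gmulg1.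
Qed.

(** * Left-orders *)

Section LeftOrders.
Context {G : group}.
Implicit Types (x y g h k : G) (lt : G -> G -> Prop).

Lemma cone_left_order (P : G -> Prop) :
  ~ P gone -> (forall x y, P x -> P y -> P (gmul x y)) ->
  (forall x, x <> gone -> P x \/ P (ginv x)) ->
  left_order (fun x y => P (gmul (ginv x) y)).
Proof.
move=> P1 PM Ptot; split=> [x|x y z xy yz|x y xy|g x y].
- by rewrite gmulVg.
- by have := PM _ _ xy yz; rewrite -gmulA gmulVKg.
- have [e|?|] := Ptot (gmul (ginv x) y); [|by left|by rewrite ginvM ginvK; right].
  by case: xy; rewrite -(gmulg1 x) -e gmulVKg.
- by rewrite ginvM -gmulA gmulKg.
Qed.

Lemma left_order_flip lt : left_order lt -> left_order (fun x y => lt y x).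
Proof.
case=> irr tr tot inv; split=> [//|x y z yx zy|x y xy|g x y].
- exact: tr zy yx.
- by case: (tot _ _ xy); [right|left].
- exact: inv.
Qed.

Lemma left_order_mull lt g x y :
  left_order lt -> lt x y -> lt (gmul g x) (gmul g y).
Proof. by case=> _ _ _; apply. Qed.

Lemma left_order_trans lt x y z : left_order lt -> lt x y -> lt y z -> lt x z.
Proof. by case=> _ tr _ _; apply: tr. Qed.

Lemma left_order_mul_pos lt x y : left_order lt ->
  lt gone x -> lt gone y -> lt gone (gmul x y).
Proof.
move=> O x0 /(left_order_mull x O); rewrite gmulg1.
exact: left_order_trans.
Qed.

Lemma left_order_inv lt x : left_order lt -> lt x gone -> lt gone (ginv x).
Proof. by move=> O /(left_order_mull (ginv x) O); rewrite gmulVg gmulg1. Qed.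

Lemma left_order_pow_pos lt x n : left_order lt ->
  lt gone x -> (0 < n)%Z -> lt gone (gpow x n).
Proof.
move=> O x0 n0; have [i ->] : exists i : nat, n = Z.of_nat i.+1.
  by exists (Z.to_nat n).-1; lia.
elim: i => [|i IH]; first by rewrite gpow1.
by rewrite Nat2Z.inj_succ gpow_succ; apply: left_order_mul_pos.
Qed.

Lemma left_order_pow_neg lt x n : left_order lt ->
  lt x gone -> (0 < n)%Z -> lt (gpow x n) gone.
Proof. by move/left_order_flip; apply: left_order_pow_pos. Qed.

End LeftOrders.

(** Induction on [T g /\ T (ginv g)], which is stable under inverses by construction; this serves
    predicates with no evident stability of their own. *)
Lemma generated_by_monoid (G : group) (a b : G) (T : G -> Prop) :
  generated_by a b -> T gone -> T a -> T b -> T (ginv a) -> T (ginv b) ->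
  (forall x y, T x -> T y -> T (gmul x y)) -> forall g, T g.
Proof.
move=> gen T1 Ta Tb Ta' Tb' TM g.
suff [] : T g /\ T (ginv g) by [].
move: g; apply: gen => //.
- by rewrite ginv1.
- by move=> x y [? ?] [? ?]; rewrite ginvM; split; apply: TM.
- by move=> x [? ?]; rewrite ginvK.
Qed.

(** * The obstruction to regularity *)

Section EvalWord.
Variables (G : group) (X : finType) (pi : X -> G).

Lemma eval_word_cat u v :
  eval_word pi (u ++ v) = gmul (eval_word pi u) (eval_word pi v).
Proof. by elim: u => [|x u IH] /=; rewrite ?gmul1g // IH gmulA. Qed.

Lemma eval_word_nseq n x : eval_word pi (nseq n x) = gpow (pi x) (Z.of_nat n).
Proof. by elim: n => [//|n IH]; rewrite Nat2Z.inj_succ gpow_succ -IH. Qed.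

(* Both [u] and [v] in an accepted [uv] may be exchanged for the fixed words
   chosen for the state reached after [u]; this bounds [m u]. *)
Lemma regular_bounded_descent (A : dfa X) (m : G -> Z) :
  (forall g h, m (gmul g h) = (m g + m h)%Z) ->
  (forall w, dfa_accepts A w -> (0 <= m (eval_word pi w))%Z) \/
  (forall w, dfa_accepts A w -> (m (eval_word pi w) <= 0)%Z) ->
  exists C : nat, forall u v, dfa_accepts A (u ++ v) ->
    m (eval_word pi (u ++ v)) = 0%Z -> (- Z.of_nat C <= m (eval_word pi u))%Z.
Proof.
move=> mM sgn; set st := foldl (@dtrans X A).
have /fin_all_exists [f Hf] : forall s, exists n : nat, forall u v,
    st (dstart A) u = s -> dfinal (st s v) ->
    m (eval_word pi (u ++ v)) = 0%Z -> (- Z.of_nat n <= m (eval_word pi u))%Z.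
  move=> s; have [[u0 [v0 [e0 f0]]]|no] :=
    classic (exists u0 v0, st (dstart A) u0 = s /\ dfinal (st s v0)).
    (* If accepted words have m >= 0, then u v0 gives m u >= - m v0. If they have m <= 0, then u0 v
       gives m u = - m v >= m u0. *)
    exists (Z.to_nat (Z.max (m (eval_word pi v0)) (- m (eval_word pi u0)))).
    move=> u v e fv; rewrite eval_word_cat mM => sum0.
    case: sgn => sgn.
      have := sgn (u ++ v0); rewrite /dfa_accepts foldl_cat -/st e => /(_ f0).
      by rewrite eval_word_cat mM; lia.
    have := sgn (u0 ++ v); rewrite /dfa_accepts foldl_cat -/st e0 => /(_ fv).
    by rewrite eval_word_cat mM; lia.
  (* No accepted word passes through s, so any bound will do. *)
  by exists 0 => u v e fv; case: no; exists u, v.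
exists (\max_s f s) => u v; rewrite /dfa_accepts foldl_cat -/st => fv sum0.
have := Hf _ _ _ erefl fv sum0.
have /leP := @leq_bigmax _ f (st (dstart A) u).
by lia.
Qed.

End EvalWord.

Lemma powq_int q n : (0 <= n)%Z -> exists z, q ^^ n = IZR z.
Proof.
move=> n0; exists (q ^ n)%Z.
by rewrite -(Z2Nat.id n n0) -pow_powerRZ pow_IZR.
Qed.

(** * Denominators of translations and signs at level m = 1 *)

Section AffineOrders.
Variables (q : Z) (G : group) (a b : G) (m : G -> Z) (r : G -> R).
Hypothesis q0 : q <> 0%Z.
Hypothesis ac : affine_coords q a b m r.
Implicit Types (g h k : G) (lt : G -> G -> Prop).

Let mM := acM ac.
Let rM := acRM ac.
Let coordE := (mM, rM, m_inv mM, r_inv mM rM, acMa ac, acRa ac, acMb ac, acRb ac,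
  m_one mM, r_one mM rM, m_pow mM).

(** Conjugating b^z to a^-i b^z a^i divides the translation length by q^i. *)
Lemma kernel_elt (i : nat) (z : Z) :
  exists k, m k = 0%Z /\ (q ^^ (Z.of_nat i) * r k = IZR z)%R.
Proof.
exists (gmul (gmul (gpow a (- Z.of_nat i)) (gpow b z)) (gpow a (Z.of_nat i))).
rewrite !coordE !(r_pow_fix q0 mM rM _ (acRa ac)) (r_pow0 mM rM _ (acMb ac)).
split; first lia.
rewrite (acRb ac) Z.mul_1_r Rmult_0_r Rplus_0_l Rplus_0_r -Rmult_assoc.
by rewrite -powqD // Z.add_opp_diag_r /=; ring.
Qed.

(** The coordinate r of w is the sum of q^(m u) r(x) over its letters x, with u the prefix before x.
    The prefix costs at most q^C in the denominator and the letter at most q^D. *)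
Lemma word_denominator (X : finType) (pi : X -> G) (C D : nat) (w : seq X) :
  (forall x, exists z, (q ^^ (Z.of_nat D) * r (pi x))%R = IZR z) ->
  (forall u v, w = u ++ v -> (- Z.of_nat C <= m (eval_word pi u))%Z) ->
  exists z, (q ^^ (Z.of_nat C + Z.of_nat D) * r (eval_word pi w))%R = IZR z.
Proof.
move=> HD; elim/last_ind: w => [|w x IH] HC.
  by exists 0%Z; rewrite /= !coordE; ring.
have [u v e|z1 e1] := IH.
  by apply: (HC u (v ++ [:: x])); rewrite catA -e cats1.
have [z2 e2] := HD x.
have [|z3 e3] := @powq_int q (Z.of_nat C + m (eval_word pi w)).
  by have := HC w [:: x]; rewrite cats1 => /(_ erefl); lia.
exists (z1 + z3 * z2)%Z.
rewrite -cats1 eval_word_cat /= gmulg1 rM plus_IZR mult_IZR -e1 -e2 -e3 !powqD //.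
ring.
Qed.

Lemma coord_sign_of_level_one lt : left_order lt ->
  (forall g, m g = 1%Z -> lt gone g) ->
  (forall g, (0 < m g)%Z -> lt gone g).
Proof.
move=> O L1 g mg; have [n] : exists n : nat, m g = (Z.of_nat n + 1)%Z.
  by exists (Z.to_nat (m g - 1)); lia.
elim: n g {mg} => [|n IH] g mg; first by apply: L1.
rewrite -(gmulVKg a g); apply: left_order_mul_pos => //.
  by apply: L1; apply: (acMa ac).
by apply: IH; rewrite !coordE mg; lia.
Qed.

Lemma level_one_not_regular lt : (2 <= Z.abs q)%Z -> left_order lt ->
  (forall g, m g = 1%Z -> lt gone g) \/ (forall g, m g = 1%Z -> lt g gone) ->
  ~ C_left_order regular lt.
Proof.
move=> q2 O L1 [X [pi [L [[A LA] _ LP]]]].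
have [irr tr tot _] := O.
have accP w : dfa_accepts A w -> lt gone (eval_word pi w).
  by move=> /LA ?; apply/LP; exists w.
have [|C HC] := @regular_bounded_descent G X pi A m mM.
  (* The sign at level one propagates to all nonzero levels, so m has a constant weak sign on
     positive elements. *)
  case: L1 => L1; [left|right] => w /accP w0.
    apply: Znot_gt_le => mw; apply: (irr gone).
    apply: tr w0 _; rewrite -(ginvK (eval_word _ _)).
    apply: (left_order_inv (left_order_flip O)).
    by apply: (coord_sign_of_level_one O L1); rewrite !coordE; lia.
  apply: Znot_gt_le => mw; apply: (irr gone); apply: tr w0 _.
  by apply: (coord_sign_of_level_one (left_order_flip O) L1); lia.
have [D HD] : exists D : nat, forall x, exists z, (q ^^ (Z.of_nat D) * r (pi x))%R = IZR z.
  have /fin_all_exists [f Hf] := fun x => acR ac (pi x).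
  exists (\max_x f x) => x; have [z e] := Hf x.
  have /leP le := @leq_bigmax _ f x.
  have [|z' e'] := @powq_int q (Z.of_nat (\max_x0 f x0) - Z.of_nat (f x)); first lia.
  exists (z' * z)%Z; rewrite mult_IZR -e -e' -Rmult_assoc -powqD //.
  by congr (Rmult (powerRZ _ _) _); lia.
have main k : m k = 0%Z -> lt gone k ->
    exists z, (q ^^ (Z.of_nat C + Z.of_nat D) * r k)%R = IZR z.
  move=> mk /LP [w [/LA acc ew]]; rewrite -ew; apply: word_denominator => // u v e.
  by apply: (HC u v); rewrite -e // ew.
(* Translation by q^-(C+D+1), one power beyond the bound; it or its inverse is positive, so 1 would
   be a multiple of q. *)
have [k [mk rk]] := kernel_elt (C + D).+1 1.
have [z e] : exists z, (q ^^ (Z.of_nat C + Z.of_nat D) * r k)%R = IZR z.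
  have [e|/tot [k0|k0]] := classic (k = gone); last exact: main.
    by rewrite e !coordE Rmult_0_r in rk; lra.
  have [|z e] := main (ginv k) _ (left_order_inv O k0); first by rewrite coordE mk.
  by exists (- z)%Z; rewrite opp_IZR -e !coordE mk /=; ring.
have : IZR (q * z) = IZR 1.
  rewrite mult_IZR -e -rk -Rmult_assoc; congr Rmult.
  have -> : Z.of_nat (C + D).+1 = (1 + (Z.of_nat C + Z.of_nat D))%Z by rewrite -plusE; lia.
  by rewrite [RHS]powqD //=; ring.
by move/eq_IZR /Z.mul_eq_1; lia.
Qed.

Lemma conj_kernel g k : m g = 1%Z -> m k = 0%Z ->
  gmul g k = gmul (gpow k q) g.
Proof.
move=> mg mk; apply: (acI ac); rewrite !coordE ?(r_pow0 mM rM _ mk) mg mk; first lia.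
by rewrite Z.mul_0_r /=; ring.
Qed.

(** Let g be positive of level one and t = k^-1 a negative translation. Then g < g k = k^q g, so k^q
    g is positive, and multiplying by k^(-q-1), positive because q <= -2, gives t g. Thus all of
    level one shares one sign. *)
Lemma neg_level_one_sign lt : (q <= -2)%Z -> left_order lt ->
  (forall g, m g = 1%Z -> lt gone g) \/ (forall g, m g = 1%Z -> lt g gone).
Proof.
move=> q2 O; have [irr tr tot _] := O.
have key g t : m g = 1%Z -> m t = 0%Z -> lt gone g -> lt gone (gmul t g).
  move=> mg mt g0; have [->|/tot [t0|t0]] := classic (t = gone).
  - by rewrite gmul1g.
  - set k := ginv t; have k0 : lt gone k by apply: left_order_inv.
    have mk : m k = 0%Z by rewrite !coordE mt.
    have gk0 : lt gone (gmul (gpow k q) g).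
      rewrite -conj_kernel //; apply: tr g0 _.
      by rewrite -{1}(gmulg1 g); apply: left_order_mull.
    have -> : gmul t g = gmul (gpow k (- q - 1)) (gmul (gpow k q) g).
      rewrite gmulA -gpow_add; have -> : (- q - 1 + q = -1)%Z by lia.
      by rewrite /= gmulg1 ginvK.
    by apply: left_order_mul_pos => //; apply: left_order_pow_pos => //; lia.
  - exact: left_order_mul_pos.
have a1 : a <> gone by move/(congr1 m); rewrite !coordE.
have split g h : h = gmul (gmul h (ginv g)) g by rewrite -gmulA gmulVg gmulg1.
have [a0|a0] := tot _ _ a1; [right|left] => g mg; last first.
  by rewrite (split a g); apply: key; rewrite ?coordE ?mg.
(* With a negative, a positive g of level one would make a = (a g^-1) g positive. *)
have [e|/tot [//|g0]] := classic (g = gone); first by move: mg; rewrite e !coordE.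
case: (irr a); apply: tr a0 _.
by rewrite (split g a); apply: key; rewrite ?coordE ?mg.
Qed.

End AffineOrders.

(** * Left-orders for q >= 2 *)

Section PositiveSlope.
Variables (q : Z) (G : group) (a b : G) (m : G -> Z) (r : G -> R).
Hypothesis q2 : (2 <= q)%Z.
Hypothesis gen : generated_by a b.
Hypothesis ac : affine_coords q a b m r.
Implicit Types (g h k s : G) (lt : G -> G -> Prop).

Let q0 : q <> 0%Z. Proof. by lia. Qed.
Let q2R : (2 <= IZR q)%R. Proof. exact: IZR_le. Qed.
Let mM := acM ac.
Let rM := acRM ac.
Let coordE := (mM, rM, m_inv mM, r_inv mM rM, acMa ac, acRa ac, acMb ac, acRb ac,
  m_one mM, r_one mM rM, m_pow mM).

(** For N with q^N (v - u) >= 2, the integer [up (u * q^N)] divided by q^N falls strictly between u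
    and v. *)
Lemma kernel_dense (u v : R) : (u < v)%R ->
  exists k, m k = 0%Z /\ (u < r k < v)%R.
Proof.
move=> uv; have [|N HN] := @Pow_x_infinity (IZR q) _ (2 / (v - u)).
  by rewrite Rabs_pos_eq; lra.
have {HN} := HN N (le_n N); rewrite Rabs_pos_eq; last by apply: pow_le; lra.
set Q := (IZR q ^ N)%R => HQ.
have Q0 : (0 < Q)%R by apply: pow_lt; lra.
have HQ' : (2 <= Q * (v - u))%R.
  have := Rmult_le_compat_r (v - u) _ _ _ (Rge_le _ _ HQ).
  by rewrite /Rdiv Rmult_assoc Rinv_l; lra.
have [k [mk rk]] := kernel_elt q0 ac N (up (u * Q)).
have [up1 up2] := archimed (u * Q).
move: rk; rewrite -pow_powerRZ -/Q => rk.
by exists k; split=> //; split; apply: (Rmult_lt_reg_l Q) => //; rewrite rk; lra.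
Qed.

(** Some positive power of k equals a positive power of b, so the sign of b decides the order of all
    translations. *)
Lemma kernel_pos lt k : left_order lt -> lt gone b ->
  m k = 0%Z -> (0 < r k)%R -> lt gone k.
Proof.
move=> O b0 mk rk; have [irr tr tot _] := O.
have [i [z e]] := acR ac k.
have Q0 : (0 < q ^^ (Z.of_nat i))%R by apply: powerRZ_lt; lra.
have z0 : (0 < z)%Z by apply: lt_IZR; rewrite -e; apply: Rmult_lt_0_compat.
have kb : gpow k (q ^ Z.of_nat i) = gpow b z.
  apply: (acI ac); rewrite ?coordE ?mk ?Z.mul_0_r //.
  rewrite (r_pow0 mM rM _ mk) (r_pow0 mM rM _ (acMb ac)) -e (acRb ac).
  by rewrite -pow_IZR pow_powerRZ; ring.
have [k1|/tot [k0|//]] := classic (k = gone).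
  by move: rk; rewrite k1 !coordE; lra.
case: (irr gone); apply: (tr _ (gpow b z)); first exact: left_order_pow_pos.
by rewrite -kb; apply: left_order_pow_neg => //; apply: Z.pow_pos_nonneg; lia.
Qed.

Lemma kernel_lt lt k k' : left_order lt -> lt gone b ->
  m k = 0%Z -> m k' = 0%Z -> (r k < r k')%R -> lt k k'.
Proof.
move=> O b0 mk mk' rkk; have /(left_order_mull k O) : lt gone (gmul (ginv k) k').
  by apply: kernel_pos; rewrite // !coordE mk /= ?mk'; [lia|lra].
by rewrite gmulg1 gmulVKg.
Qed.

(* [h] sits in the order where the translation by [y - x] would. *)
Definition located lt (x : R) h (y : R) := forall k, m k = 0%Z ->
  ((r k < y - x)%R -> lt k h) /\ ((y - x < r k)%R -> lt h k).

Lemma located_act lt x : left_order lt ->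
  located lt x a (IZR q * x) -> forall g h y, located lt x h y ->
  located lt x (gmul g h) (q ^^ (m g) * y + r g).
Proof.
move=> O Ya; have [irr tr tot inv] := O.
have scale u v : (IZR q * u < IZR q * v)%R -> (u < v)%R.
  by apply: Rmult_lt_reg_l; lra.
have conjE k s : m k = 0%Z -> m s = 0%Z ->
    [/\ m (gmul (gmul (ginv a) (gmul (ginv s) k)) a) = 0%Z,
        (IZR q * r (gmul (gmul (ginv a) (gmul (ginv s) k)) a) = r k - r s)%R,
        m (gmul (gmul (gmul a k) (ginv a)) s) = 0%Z,
        (r (gmul (gmul (gmul a k) (ginv a)) s) = IZR q * r k + r s)%R &
        gmul (gmul (ginv s) k) s = k].
  move=> mk ms; split; try by rewrite !coordE ?mk ?ms.
  - by rewrite !coordE ms mk /=; field; lra.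
  - by rewrite !coordE mk /=; field; lra.
  - by apply: (acI ac); rewrite !coordE ms mk //=; ring.
apply: (generated_by_monoid gen) => [h y|h y Yh k mk|h y Yh k mk|h y Yh k mk|h y Yh k mk|].
- by rewrite gmul1g !coordE /= Rmult_1_l Rplus_0_r.
- rewrite !coordE /=; split=> lk.
    (* For s < a close to the cut and k' = a^-1 s^-1 k a, one has k = (s^-1 k) s < (s^-1 k) a = a k'
       < a h. *)
    have [|s [ms [s1 s2]]] := @kernel_dense (r k - IZR q * (y - x)) (IZR q * x - x).
      by lra.
    have [mk' rk' _ _ kE] := conjE _ _ mk ms.
    have [/(_ s2) /(inv (gmul (ginv s) k)) sa _] := Ya s ms; rewrite kE in sa.
    apply: tr sa _; have [/(_ _) + _] := Yh _ mk'.
    have lk' : (r (gmul (gmul (ginv a) (gmul (ginv s) k)) a) < y - x)%R.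
      by apply: scale; rewrite rk'; lra.
    by move=> /(_ lk') /(inv a); rewrite -!gmulA gmulVKg.
  have [|s [ms [s1 s2]]] := @kernel_dense (IZR q * x - x) (r k - IZR q * (y - x)).
    by lra.
  have [mk' rk' _ _ kE] := conjE _ _ mk ms.
  have [_ /(_ s1) /(inv (gmul (ginv s) k)) sa] := Ya s ms; rewrite kE in sa.
  apply: tr _ sa; have [_ /(_ _) +] := Yh _ mk'.
  have lk' : (y - x < r (gmul (gmul (ginv a) (gmul (ginv s) k)) a))%R.
    by apply: scale; rewrite rk'; lra.
  by move=> /(_ lk') /(inv a); rewrite -!gmulA gmulVKg.
- rewrite !coordE /=; have [|H1 H2] := Yh (gmul (ginv b) k).
    by rewrite !coordE mk.
  move: H1 H2; rewrite !coordE /=; split=> lk.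
    by rewrite -(gmulVKg b k); apply: inv; apply: H1; lra.
  by rewrite -(gmulVKg b k); apply: inv; apply: H2; lra.
- rewrite !coordE /=.
  have yE : (/ (IZR q * 1) * y + - (/ (IZR q * 1) * 0) = / IZR q * y)%R by field; lra.
  have qy : (IZR q * (/ IZR q * y - x) = y - IZR q * x)%R by field; lra.
  rewrite yE; split=> /(Rmult_lt_compat_l (IZR q) _ _ ltac:(lra)); rewrite qy => lk.
    (* For a < s close to the cut, a k = (a k a^-1) a < (a k a^-1) s < h, the third term being a
       translation. *)
    have [|s [ms [s1 s2]]] := @kernel_dense (IZR q * x - x) (y - x - IZR q * r k).
      by lra.
    have [_ _ mk' rk' _] := conjE _ _ mk ms.
    have [_ /(_ s1) /(inv (gmul (gmul a k) (ginv a))) sa] := Ya s ms.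
    rewrite -(gmulKg a k); apply: inv; move: sa; rewrite -[X in lt X _]gmulA gmulVg gmulg1 => sa.
    by apply: tr sa _; have [+ _] := Yh _ mk'; apply; rewrite rk'; lra.
  have [|s [ms [s1 s2]]] := @kernel_dense (y - x - IZR q * r k) (IZR q * x - x).
    by lra.
  have [_ _ mk' rk' _] := conjE _ _ mk ms.
  have [/(_ s2) /(inv (gmul (gmul a k) (ginv a))) sa _] := Ya s ms.
  rewrite -(gmulKg a k); apply: inv; move: sa; rewrite -[X in lt _ X]gmulA gmulVg gmulg1 => sa.
  by apply: tr _ sa; have [_ +] := Yh _ mk'; apply; rewrite rk'; lra.
- rewrite !coordE /=; have [|H1 H2] := Yh (gmul b k).
    by rewrite !coordE mk.
  move: H1 H2; rewrite !coordE /=; split=> lk.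
    by rewrite -(gmulKg b k); apply: inv; apply: H1; lra.
  by rewrite -(gmulKg b k); apply: inv; apply: H2; lra.
move=> g g' H H' h y Yh; rewrite !coordE -gmulA.
by have := H _ _ (H' _ _ Yh); rewrite powqD //; congr located; ring.
Qed.

Lemma affine_or_level_one lt : left_order lt -> lt gone b ->
  (forall g, m g = 1%Z -> lt gone g) \/ (forall g, m g = 1%Z -> lt g gone) \/
  exists x, forall g, ((x < q ^^ (m g) * x + r g)%R -> lt gone g) /\
                      ((q ^^ (m g) * x + r g < x)%R -> lt g gone).
Proof.
move=> O b0; have [irr tr tot inv] := O.
have aK k : m k = 0%Z -> lt k a \/ lt a k.
  by move=> mk; apply: tot => e; move: mk; rewrite e !coordE.
have split g : g = gmul (gmul g (ginv a)) a by rewrite -gmulA gmulVg gmulg1.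
have split0 g : m g = 1%Z -> m (gmul a (ginv g)) = 0%Z by move=> mg; rewrite !coordE mg.
have splitE g : gmul (gmul g (ginv a)) (gmul a (ginv g)) = gone.
  by rewrite -gmulA gmulKg gmulgV.
have [up|] := classic (forall k, m k = 0%Z -> lt k a).
  (* The translation a g^-1 lies below a; multiplying by g a^-1 gives 1 < g. *)
  left=> g mg; rewrite (split g) -(splitE g).
  by apply: inv; apply: up; apply: split0.
move=> nall1; have [k1 nk1] := not_all_ex_not _ _ nall1.
have [mk1 k1a] := imply_to_and _ _ nk1.
have {}k1a : lt a k1 by case: (aK _ mk1).
right; have [down|] := classic (forall k, m k = 0%Z -> lt a k).
  left=> g mg; rewrite {1}(split g) -(splitE g).
  by apply: inv; apply: down; apply: split0.
move=> nall2; have [k2 nk2] := not_all_ex_not _ _ nall2.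
have [mk2 k2a] := imply_to_and _ _ nk2.
have {}k2a : lt k2 a by case: (aK _ mk2).
right; pose E u := exists k, [/\ m k = 0%Z, lt k a & u = r k].
have bE : bound E.
  exists (r k1) => _ [k [mk ka ->]]; apply: Rnot_lt_le => rk.
  apply: (irr a); apply: (tr _ _ _ k1a); apply: tr ka.
  exact: (@kernel_lt lt).
have [t [ub lub]] := completeness E bE (ex_intro _ _ (ex_intro _ k2 (And3 mk2 k2a erefl))).
(* The point that x |-> q x displaces by exactly t, the supremum of the translations below a. *)
pose x := (t / (IZR q - 1))%R.
have tE : (IZR q * x - x = t)%R by rewrite /x; field; lra.
have Ya : located lt x a (IZR q * x).
  move=> k mk; rewrite tE; split=> rk.
    case: (aK _ mk) => // ak; case: (Rlt_not_le _ _ rk); apply: lub => _ [k' [mk' k'a ->]].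
    apply: Rnot_lt_le => rk'; apply: (irr a); apply: (tr _ _ _ ak); apply: tr k'a.
    exact: (@kernel_lt lt).
  case: (aK _ mk) => // ka; case: (Rlt_not_le _ _ rk); apply: ub.
  by exists k.
have Y1 : located lt x gone x.
  by move=> k mk; split=> rk; apply: (@kernel_lt lt) => //; rewrite ?coordE //; lra.
(* As 1 sits at x, g = g 1 sits at the image of x under g; comparison with the trivial translation
   gives its sign. *)
exists x => g; have := located_act O Ya g Y1; rewrite gmulg1 => /(_ gone (m_one mM)).
by rewrite !coordE => -[H1 H2]; split=> H; [apply: H1|apply: H2]; lra.
Qed.

Lemma affine_action rho : action_on_R rho ->
  (forall x : R, rho a x = (IZR q * x)%R) -> (forall x : R, rho b x = (x + 1)%R) ->
  forall g x, rho g x = (q ^^ (m g) * x + r g)%R.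
Proof.
move=> rhoM rhoa rhob.
(* [action_on_R] does not state that the identity acts trivially; this follows from the surjectivity
   of [rho a]. *)
have rho1 x : rho gone x = x.
  have -> : x = rho a (x / IZR q)%R by rewrite rhoa; field; lra.
  by rewrite -rhoM gmul1g.
have rhoK g x : rho g (rho (ginv g) x) = x by rewrite -rhoM gmulgV.
apply: (generated_by_monoid gen) => [x|x|x|x|x|g h Hg Hh x]; rewrite ?coordE /=.
- by rewrite rho1; ring.
- by rewrite rhoa; ring.
- by rewrite rhob; ring.
- by have := rhoK a x; rewrite rhoa => {2}<-; field; lra.
- by have := rhoK b x; rewrite rhob => {2}<-; ring.
- by rewrite rhoM Hh Hg powqD //; ring.
Qed.

Lemma regular_induced lt rho : left_order lt -> C_left_order regular lt ->
  action_on_R rho ->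
  (forall x : R, rho a x = (IZR q * x)%R) -> (forall x : R, rho b x = (x + 1)%R) ->
  induced_by_action rho lt.
Proof.
move=> O Creg rhoM rhoa rhob; have [irr tr tot _] := O.
have rhoE := affine_action rhoM rhoa rhob.
have nreg : (forall g, m g = 1%Z -> lt gone g) \/ (forall g, m g = 1%Z -> lt g gone) ->
    induced_by_action rho lt.
  by move=> L1; case: (level_one_not_regular q0 ac _ O L1 Creg); lia.
have b1 : b <> gone by move/(congr1 r); rewrite !coordE; lra.
have cmp (x y : R) : x <> y -> (x < y)%R \/ (y < x)%R by lra.
case: (tot _ _ b1) => b0.
  (* For b negative the opposite order is analysed, which exchanges the signs and yields the second
     form of an induced order. *)
  have [L|[L|[x Hx]]] := affine_or_level_one (left_order_flip O) b0.
  - by apply: nreg; right.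
  - by apply: nreg; left.
  exists x; right=> g; have [] := Hx g; rewrite -rhoE => H1 H2 /cmp.
  case=> lx; split=> // gx.
  by case: (irr gone); apply: tr gx _; apply: H1.
have [L|[L|[x Hx]]] := affine_or_level_one O b0.
- by apply: nreg; left.
- by apply: nreg; right.
exists x; left=> g; have [] := Hx g; rewrite -rhoE => H1 H2 /cmp.
case=> lx; split=> // gx.
by case: (irr gone); apply: tr gx _; apply: H2.
Qed.

End PositiveSlope.

(** * Automata for positive cones *)

Lemma regular_one_counter (X : finType) (L : language X) :
  regular L -> one_counter L.
Proof.
case=> A LA.
(* With [opmax] equal to 0 nothing is pushed, so the counter stays at its initial value 0. *)
pose B := @OCA X (dstate A) (dstart A) (@dfinal X A) 0
  (fun s o z s' k => if o is Some x then s' == dtrans s x else false).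
exists B => w; rewrite LA /dfa_accepts; split=> [acc|[s [n []]]].
  exists (foldl (@dtrans X A) (dstart A) w), 0; split=> //.
  rewrite -[ostart B]/(dstart A); elim: w (dstart A) {acc} => [|x w IH] s.
    exact: (@oca_run_nil X B s 0).
  by apply: (@oca_run_step X B s 0 (Some x) (dtrans s x) ord0) => //=.
rewrite -[dstart A]/(ostart B); elim=> [//|{}s {}n [x|] s' k v s'' n'' //= /eqP-> _].
exact.
Qed.

Section Soundness.
Variables (G : group) (X : finType) (pi : X -> G).

(* [Inv s] contains the values of the words accepted from the state [s]. *)
Lemma dfa_sound (A : dfa X) (Inv : dstate A -> G -> Prop) :
  (forall s, dfinal s -> Inv s gone) ->
  (forall s x g, Inv (dtrans s x) g -> Inv s (gmul (pi x) g)) ->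
  forall w, dfa_accepts A w -> Inv (dstart A) (eval_word pi w).
Proof.
move=> Ifin Istep w; rewrite /dfa_accepts; elim: w (dstart A) => [|x w IH] s //=.
  exact: Ifin.
by move=> /IH; apply: Istep.
Qed.

Lemma oca_sound (A : oca X) (Inv : ostate A -> nat -> G -> Prop) :
  (forall s n, ofinal s -> Inv s n gone) ->
  (forall s n o s' k g, otrans s o (n == 0) s' k ->
     Inv s' (if n == 0 then k : nat else n.-1 + k) g ->
     Inv s n (if o is Some x then gmul (pi x) g else g)) ->
  forall w, oca_accepts A w -> Inv (ostart A) 0 (eval_word pi w).
Proof.
move=> Ifin Istep w [s [n [run fin]]].
elim: run fin => [{}s {}n|{}s {}n o s' k v s'' n'' tr _ IH] fin /=; first exact: Ifin.
by have := Istep _ _ _ _ _ _ tr (IH fin); case: o {tr}.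
Qed.

Lemma oca_run_move (A : oca X) s n o s' n' (k : 'I_(opmax A).+1) w s'' n'' :
  otrans s o (n == 0) s' k -> (if n == 0 then k : nat else n.-1 + k) = n' ->
  @oca_run X A s' n' w s'' n'' -> @oca_run X A s n (ocons o w) s'' n''.
Proof. by move=> tr <-; apply: oca_run_step. Qed.

Lemma words_generate (a b : G) : generated_by a b ->
  (exists w, eval_word pi w = a) -> (exists w, eval_word pi w = b) ->
  (exists w, eval_word pi w = ginv a) -> (exists w, eval_word pi w = ginv b) ->
  forall g, exists w, eval_word pi w = g.
Proof.
move=> gen wa wb wa' wb'; apply: (generated_by_monoid gen) => //; first by exists [::].
by move=> x y [u <-] [v <-]; exists (u ++ v); rewrite eval_word_cat.
Qed.

Lemma cone_C_left_order (C : lang_class) (P : G -> Prop) (L : language X) :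
  ~ P gone -> (forall x y, P x -> P y -> P (gmul x y)) ->
  (forall x, x <> gone -> P x \/ P (ginv x)) ->
  C X L -> (forall g, exists w, eval_word pi w = g) ->
  (forall w, L w -> P (eval_word pi w)) ->
  (forall g, P g -> exists w, L w /\ eval_word pi w = g) ->
  exists lt : G -> G -> Prop, left_order lt /\ C_left_order C lt.
Proof.
move=> P1 PM Ptot CL gen sound complete.
exists (fun x y => P (gmul (ginv x) y)); split; first exact: cone_left_order.
exists X, pi, L; split=> // g; rewrite ginv1 gmul1g; split; first exact: complete.
by move=> [w [/sound + <-]].
Qed.

End Soundness.

(* [la], [lA], [lb], [lB] stand for a, a^-1, b, b^-1; the same four values also
   serve as names of automaton states. *)
Definition letter : finType := (bool * bool)%type.
Local Notation la := (true, true).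
Local Notation lA := (true, false).
Local Notation lb := (false, true).
Local Notation lB := (false, false).

Definition letter_val (G : group) (a b : G) (x : letter) : G :=
  match x with la => a | lA => ginv a | lb => b | lB => ginv b end.

Lemma letters_generate (G : group) (a b : G) : generated_by a b ->
  forall g, exists w, eval_word (letter_val a b) w = g.
Proof.
move=> gen; apply: (words_generate gen);
  [exists [:: la]|exists [:: lb]|exists [:: lA]|exists [:: lB]]; exact: gmulg1.
Qed.

Lemma foldl_nseq_fix (S X : Type) (f : S -> X -> S) s x n :
  f s x = s -> foldl f s (nseq n x) = s.
Proof. by move=> e; elim: n => //= n; rewrite e. Qed.

Lemma BS0_regular (G : group) (a b : G) : BS_presentation 0 a b ->
  exists lt : G -> G -> Prop, left_order lt /\ C_left_order regular lt.
Proof.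
move=> HBS; have nf := BS_normal_form HBS; case: HBS => gen rel univ.
have b1 : b = gone.
  apply: (@gmulgI _ a); rewrite gmulg1.
  by move: rel => /(congr1 (fun x => gmul x a)); rewrite -gmulA gmulVg gmulg1 gmul1g.
have one_nz : 1%Z <> 0%Z by [].
(* The relation only kills b, so the affine group for q = 1 can serve to define the exponent of
   a. *)
have [|f [fM fa _]] := univ (aff_group one_nz) (1%Z, 0%R) (0%Z, 0%R).
  by rewrite /bs_rel /= /aff_mul /=; f_equal; ring.
pose m g := (f g).1.
have mM g h : m (gmul g h) = (m g + m h)%Z by rewrite /m fM.
have ma : m a = 1%Z by rewrite /m fa.
have bk k : gpow b k = gone.
  rewrite b1; elim/Z.peano_ind: k => [//|k IH|k IH]; first by rewrite gpow_succ IH gmulg1.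
  by rewrite -(gmul1g (gpow _ _)) -gpow_succ Z.succ_pred.
have gE g : g = gpow a (m g).
  have [i [j [k e]]] := nf g; apply: (@gmulgI _ (gpow a (Z.of_nat i))).
  rewrite bk gmul1g in e; rewrite -gpow_add e.
  by have := congr1 m e; rewrite mM !(m_pow mM) ma => me; congr gpow; lia.
(* The language a^+, with [None] as sink. *)
pose A := @DFA letter (option bool) (Some false) (fun s => s == Some true)
  (fun s x => match s, x with Some _, la => Some true | _, _ => None end).
apply: (@cone_C_left_order _ _ (letter_val a b) regular (fun g => 0 < m g)%Z (dfa_accepts A)).
- by rewrite (m_one mM); lia.
- by move=> x y; rewrite mM; lia.
- move=> x x1; rewrite (m_inv mM); suff : m x <> 0%Z by lia.
  by move=> m0; apply: x1; rewrite (gE x) m0.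
- by exists A.
- exact: letters_generate.
- move=> w acc.
  apply: (@dfa_sound _ _ _ A (fun s g => match s with
    Some true => 0 <= m g | Some false => 0 < m g | None => False end)%Z) acc.
    by move=> [[]|] //= _; rewrite (m_one mM).
  by move=> [[]|] [[] []] g //=; rewrite mM ma; lia.
move=> g g0; exists (nseq (Z.to_nat (m g)) la); split.
  case e : (Z.to_nat (m g)) => [|n]; first lia.
  by rewrite /dfa_accepts /= foldl_nseq_fix.
by rewrite eval_word_nseq Z2Nat.id; [rewrite /= -gE|lia].
Qed.

Local Ltac coord_cases :=
  repeat match goal with
  | H : _ /\ _ |- _ => destruct H
  | H : _ \/ _ |- _ => destruct H
  end;
  first [lia | nra | left; first [lia | nra] | right; split; first [lia | nra]
        | split; first [lia | nra]].

(** * Explicit orders for nonzero q *)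

Section Constructions.
Variables (q : Z) (G : group) (a b : G) (m : G -> Z) (r : G -> R).
Hypothesis q0 : q <> 0%Z.
Hypothesis gen : generated_by a b.
Hypothesis ac : affine_coords q a b m r.
Implicit Types (g h k : G).

Let mM := acM ac.
Let rM := acRM ac.
Let coordE := (mM, rM, m_inv mM, r_inv mM rM, acMa ac, acRa ac, acMb ac, acRb ac,
  m_one mM, r_one mM rM, m_pow mM).

Let powE : (q ^^ 0 = 1)%R * (q ^^ 1 = IZR q)%R * (q ^^ (Z.opp 0) = 1)%R *
  (q ^^ (Z.opp 1) = / IZR q)%R.
Proof. by rewrite /= Rmult_1_r. Qed.

Definition lex_pos g := (0 < m g)%Z \/ (m g = 0%Z /\ (0 < r g)%R).

Lemma lex_pos1 : ~ lex_pos gone.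
Proof. by rewrite /lex_pos !coordE => -[|[_]]; [lia|lra]. Qed.

Lemma lex_posM x y : lex_pos x -> lex_pos y -> lex_pos (gmul x y).
Proof.
rewrite /lex_pos !coordE => -[mx|[mx rx]] [my|[my ry]]; try by left; lia.
by right; rewrite mx my /=; split=> //; lra.
Qed.

Lemma lex_pos_total x : x <> gone -> lex_pos x \/ lex_pos (ginv x).
Proof.
rewrite /lex_pos !coordE => x1.
have [|[mx|]] : (0 < m x)%Z \/ m x = 0%Z \/ (m x < 0)%Z by lia.
- by left; left.
- rewrite mx /=; have [rx|rx] := classic (r x = 0%R).
    by case: x1; apply: (acI ac); rewrite !coordE.
  have [|] : (0 < r x)%R \/ (r x < 0)%R by lra.
    by left; right.
  by right; right; split=> //; lra.
- by right; left; lia.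
Qed.

Let nseq_b := r_pow0 mM rM.
Let nseq_a := r_pow_fix q0 mM rM.

Definition b_power (z : Z) : seq letter := nseq (Z.abs_nat z) (if (z <? 0)%Z then lB else lb).

Lemma eval_b_power c z : eval_word (letter_val c b) (b_power z) = gpow b z.
Proof.
apply: (acI ac); rewrite eval_word_nseq ?coordE.
  by case: ifP => _ /=; rewrite ?coordE; lia.
rewrite (nseq_b _ (acMb ac)) nseq_b; last by case: ifP => _ /=; rewrite ?coordE.
by rewrite Zabs2Nat.id_abs; case: Z.ltb_spec => z0 /=; rewrite !coordE /= abs_IZR;
  [rewrite Rabs_left1|rewrite Rabs_pos_eq]; try lra; apply: IZR_le; lia.
Qed.

Lemma unit_slope_regular : q = 1%Z \/ q = (-1)%Z ->
  exists lt : G -> G -> Prop, left_order lt /\ C_left_order regular lt.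
Proof.
move=> q1.
(* The language [b^+] or [{b, b^-1}^* a^+]. *)
pose A := @DFA letter (option letter) (Some la) (fun s => (s == Some lb) || (s == Some lA))
  (fun s x => match x, s with
   | lb, Some la | lb, Some lb => Some lb
   | lb, Some lB | lB, Some la | lB, Some lb | lB, Some lB => Some lB
   | la, Some _ => Some lA
   | _, _ => None end).
apply: (@cone_C_left_order _ _ (letter_val a b) regular lex_pos (dfa_accepts A)).
- exact: lex_pos1.
- exact: lex_posM.
- exact: lex_pos_total.
- by exists A.
- exact: letters_generate.
- move=> w acc.
  (* After [lb] only letters b have been read; after [lB] a letter a is still due; after [lA] only
     letters a may follow. *)
  apply: (@dfa_sound _ _ _ A (fun s g => match s with
    | Some la => lex_pos g
    | Some lb => (0 < m g)%Z \/ (m g = 0%Z /\ (0 <= r g)%R)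
    | Some lB => (0 < m g)%Z
    | Some lA => (0 <= m g)%Z /\ r g = 0%R
    | None => False end)) acc.
    by move=> [[[] []]|] //= _; rewrite ?coordE; coord_cases.
  by move=> [[[] []]|] [[] []] g //=; rewrite /lex_pos ?coordE ?powE => H;
    coord_cases.
move=> g g0.
(* As q is 1 or -1, q^i is its own inverse, so r g has no denominator. *)
have [z rz] : exists z, r g = IZR z.
  have [i [z e]] := acR ac g; have [|z' e'] := @powq_int q (Z.of_nat i); first lia.
  have Q1 : (q ^^ (Z.of_nat i) * q ^^ (Z.of_nat i) = 1)%R.
    rewrite -pow_powerRZ; elim: i {e e'} => [|i IH] /=; first ring.
    by case: q1 IH => -> /= IH; lra.
  by exists (z' * z)%Z; rewrite mult_IZR -e -e' -Rmult_assoc Q1; ring.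
exists (b_power z ++ nseq (Z.to_nat (m g)) la); split; last first.
  apply: (acI ac); rewrite eval_word_cat eval_b_power eval_word_nseq /= !coordE.
    by case: g0; lia.
  rewrite (nseq_a _ (acRa ac)) (nseq_b _ (acMb ac)) (acRb ac) rz; ring.
rewrite /dfa_accepts foldl_cat; set s := foldl _ (dstart A) _.
have sE : s = if (z <? 0)%Z then Some lB else if (z =? 0)%Z then Some la else Some lb.
  rewrite /s /b_power; case: Z.ltb_spec => z0.
    have -> : Z.abs_nat z = (Z.abs_nat z).-1.+1 by lia.
    by rewrite /= foldl_nseq_fix.
  case: Z.eqb_spec => [->//|z1]; have -> : Z.abs_nat z = (Z.abs_nat z).-1.+1 by lia.
  by rewrite /= foldl_nseq_fix.
case: g0 => [mg|[mg rg]].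
  have -> : Z.to_nat (m g) = (Z.to_nat (m g)).-1.+1 by lia.
  by rewrite /= sE; case: ifP => _; [|case: ifP => _]; rewrite foldl_nseq_fix.
rewrite mg /= sE; have z0 : (0 < z)%Z by apply: lt_IZR; rewrite -rz.
by case: Z.ltb_spec => ?; [lia|case: Z.eqb_spec; [lia|]].
Qed.

(** Here r g is the image of 0; the stabilizer of 0, the powers of a, is ordered by exponent. *)
Definition point_pos g := (0 < r g)%R \/ (r g = 0%R /\ (0 < m g)%Z).

Lemma expanding_regular : (2 <= q)%Z ->
  exists lt : G -> G -> Prop, left_order lt /\ C_left_order regular lt.
Proof.
move=> q2; have q2R : (2 <= IZR q)%R by apply: IZR_le.
have Q0 n : (0 < q ^^ n)%R by apply: powerRZ_lt; lra.
(* The words over [a, a^-1, b] that contain a [b], and [a^+]. *)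
pose A := @DFA letter (option letter) (Some la) (fun s => (s == Some lb) || (s == Some lA))
  (fun s x => match x, s with
   | lb, Some _ => Some lb
   | lA, Some lb | la, Some lb => Some lb
   | lA, Some _ => Some lB
   | la, Some la | la, Some lA => Some lA
   | la, Some lB => Some lB
   | _, _ => None end).
apply: (@cone_C_left_order _ _ (letter_val a b) regular point_pos (dfa_accepts A)).
- by rewrite /point_pos !coordE => -[|[_]]; [lra|lia].
- move=> x y; rewrite /point_pos !coordE.
  have Qx := Q0 (m x).
  move=> [rx|[rx mx]] [ry|[ry my]].
  + by left; have := Rmult_lt_0_compat _ _ Qx ry; lra.
  + by left; rewrite ry; lra.
  + by left; have := Rmult_lt_0_compat _ _ Qx ry; lra.
  + by right; split; [rewrite rx ry; ring|lia].
- move=> x x1; rewrite /point_pos !coordE; have Qx := Q0 (- m x)%Z.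
  have [rx|[rx|rx]] : (0 < r x \/ r x = 0 \/ r x < 0)%R by lra.
  + by left; left.
  + have mx : m x <> 0%Z by move=> mx; apply: x1; apply: (acI ac); rewrite !coordE.
    have [mx'|mx'] : (0 < m x)%Z \/ (m x < 0)%Z by lia.
      by left; right.
    by right; right; rewrite rx; split; [ring|lia].
  + right; left; have := Rmult_lt_0_compat _ (- r x) Qx; lra.
- by exists A.
- exact: letters_generate.
- move=> w acc.
  (* In [lB] a letter a^-1 has occurred and a b is still due; in [lb] a b has been read; in [lA]
     only letters a have been read. *)
  apply: (@dfa_sound _ _ _ A (fun s g => match s with
    | Some la => point_pos g
    | Some lA => (0 < r g)%R \/ (r g = 0%R /\ (0 <= m g)%Z)
    | Some lB => (0 < r g)%R
    | Some lb => (0 <= r g)%R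
    | None => False end)) acc.
    by move=> [[[] []]|] //= _; rewrite ?coordE; coord_cases.
  have [qV qV'] : (0 < / IZR q /\ IZR q * / IZR q = 1)%R.
    by split; [apply: Rinv_0_lt_compat|apply: Rinv_r]; lra.
  by move=> [[[] []]|] [[] []] g //=; rewrite /point_pos ?coordE ?powE => H;
    coord_cases.
move=> g [rg|[rg mg]]; last first.
  exists (nseq (Z.to_nat (m g)) la); split.
    have -> : Z.to_nat (m g) = (Z.to_nat (m g)).-1.+1 by lia.
    by rewrite /dfa_accepts /= foldl_nseq_fix.
  apply: (acI ac); rewrite eval_word_nseq /= ?(nseq_a _ (acRa ac)) ?coordE //.
  by lia.
have [i [z e]] := acR ac g.
have z0 : (0 < z)%Z by apply: lt_IZR; rewrite -e; apply: Rmult_lt_0_compat.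
(* g = a^-i b^z a^M, where z > 0 supplies the mandatory b. *)
pose M := (m g + Z.of_nat i)%Z.
exists (nseq i lA ++ nseq (Z.to_nat z) lb ++
        nseq (Z.abs_nat M) (if (M <? 0)%Z then lA else la)); split.
  rewrite /dfa_accepts !foldl_cat.
  have -> : Z.to_nat z = (Z.to_nat z).-1.+1 by lia.
  set s := foldl _ (dstart A) _; have [s' ->] : exists s', s = Some s'.
    by rewrite /s; case: (i) => [|j]; eexists => //=; rewrite foldl_nseq_fix.
  by rewrite /= (foldl_nseq_fix (s := Some lb)) //; case: ifP => _; rewrite foldl_nseq_fix.
apply: (acI ac); rewrite !eval_word_cat !eval_word_nseq /=.
  by rewrite !coordE /M; case: Z.ltb_spec => ? /=; rewrite ?coordE; lia.
have rA : r (ginv a) = 0%R by rewrite !coordE; ring.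
rewrite !rM (nseq_a _ rA) (nseq_b _ (acMb ac)).
rewrite (_ : r (gpow (letter_val _ _ _) _) = 0%R); last first.
  by apply: nseq_a; case: ifP => _; rewrite /= ?rA ?coordE.
rewrite !coordE Z2Nat.id; last lia.
rewrite -e; have -> : (Z.of_nat i * - (1))%Z = (- Z.of_nat i)%Z by lia.
by rewrite Rmult_0_r Rplus_0_l Rplus_0_r Rmult_1_r -Rmult_assoc powqVl //; ring.
Qed.

(* [Some la] and [Some lA] stand for a^2 and a^-2, and [None] for a: even
   powers make conjugation by them preserve the sign of [r] when [q < 0]. *)
Definition cletter : finType := option letter.

Definition cletter_val (x : cletter) : G :=
  if x is Some y then letter_val (gmul a a) b y else a.

(* The start state [la] counts the letters a^-2; [lA] reads [b^k] and then pops
   with a^2, [lb] does the same for arbitrary words in b, b^-1 but must be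
   followed by a letter a; [lB] is final. *)
Definition lex_trans (s : letter) (o : option cletter) (z : bool) (s' : letter)
    (k : 'I_3) : bool :=
  match s, o, s' with
  | la, Some (Some lA), la => k == (if z then 1 else 2) :> nat
  | la, Some (Some lb), lA | lA, Some (Some lb), lA
  | la, None, lb | lb, Some (Some lb), lb | lb, Some (Some lB), lb
  | lB, Some None, lB => k == (if z then 0 else 1) :> nat
  | lA, Some (Some la), lA | lb, Some (Some la), lb => ~~ z && (k == 0 :> nat)
  | lb, Some None, lB | lA, None, lB => z && (k == 0 :> nat)
  | _, _, _ => false
  end.

Definition lex_oca : oca cletter := @OCA cletter letter la (pred1 lB) 2 lex_trans.

(** Before [lB], each counted a^-2 must still be cancelled by a popped a^2, whence the threshold 2n
    for m of the remaining word. *)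
Definition lex_inv (s : letter) (n : nat) g : Prop :=
  match s with
  | la => (2 * Z.of_nat n < m g)%Z \/ (m g = 2 * Z.of_nat n /\ (0 < r g)%R)%Z
  | lA => (2 * Z.of_nat n < m g)%Z \/ (m g = 2 * Z.of_nat n /\ (0 <= r g)%R)%Z
  | lb => (2 * Z.of_nat n < m g)%Z
  | lB => (0 <= m g)%Z /\ r g = 0%R
  end.

Arguments lex_inv : simpl never.

Lemma lex_oca_sound w : oca_accepts lex_oca w -> lex_pos (eval_word cletter_val w).
Proof.
move=> /(@oca_sound _ _ cletter_val lex_oca lex_inv); apply.
  by move=> [[] []] n // _; rewrite /lex_inv !coordE; split; [lia|lra].
have q2 : q ^^ (1 + 1) = (IZR q * IZR q)%R by rewrite /= Rmult_1_r.
have q2' : q ^^ (Z.opp (1 + 1)) = (/ (IZR q * IZR q))%R by rewrite /= Rmult_1_r.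
have qq : (0 < IZR q * IZR q)%R.
  by apply: Rsqr_pos_lt; apply: IZR_nz.
have qq' := Rinv_0_lt_compat _ qq.
move=> [[] []] [|n] [[[[] []]|]|] [[] []] k g //=; rewrite /lex_trans //=.
all: move=> /eqP kE; rewrite /lex_inv ?kE ?addn1 ?addn2 ?addn0 ?coordE ?powE ?q2 ?q2' => H;
  try by coord_cases.
(* The remaining case is the silent move from [lA] to [lB], where 0 <= m g must be split. *)
have {H} : ((0 < m g)%Z \/ m g = 0%Z) /\ r g = 0%R by case: H => mg ?; split; first lia.
by move=> H; coord_cases.
Qed.

Lemma lex_run_push n i w s'' n'' : @oca_run _ lex_oca la (n + i) w s'' n'' ->
  @oca_run _ lex_oca la n (nseq i (Some lA) ++ w) s'' n''.
Proof.
elim: i n => [|i IH] n; first by rewrite addn0.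
rewrite addnS -addSn => /IH run.
by case: n run => [|n] run;
  [apply: (@oca_run_move _ lex_oca _ _ (Some (Some lA)) _ _ (@Ordinal 3 1 isT) _ _ _ _ _ run)
  |apply: (@oca_run_move _ lex_oca _ _ (Some (Some lA)) _ _ (@Ordinal 3 2 isT) _ _ _ _ _ run)];
  rewrite //= addn2.
Qed.

(** Keeping the counter means pushing nothing on the bottom marker, but one copy in place of a stack
    symbol. *)
Lemma lex_run_keep (s s' : letter) o n w s'' n'' :
  (forall z, lex_trans s o z s' (if z then ord0 else @Ordinal 3 1 isT)) ->
  @oca_run _ lex_oca s' n w s'' n'' -> @oca_run _ lex_oca s n (ocons o w) s'' n''.
Proof.
move=> tr run.
apply: (@oca_run_move _ lex_oca _ _ o _ _ _ _ _ _ (tr (n == 0)) _ run).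
by case: n {run} => //= n; rewrite addn1.
Qed.

Lemma lex_run_keeps (s : letter) x n j w s'' n'' :
  (forall z, lex_trans s (Some x) z s (if z then ord0 else @Ordinal 3 1 isT)) ->
  @oca_run _ lex_oca s n w s'' n'' -> @oca_run _ lex_oca s n (nseq j x ++ w) s'' n''.
Proof.
by move=> tr run; elim: j => //= j IH; apply: (@lex_run_keep _ s (Some x)).
Qed.

Lemma lex_run_pop (s : letter) i w s'' n'' :
  lex_trans s (Some (Some la)) false s ord0 ->
  @oca_run _ lex_oca s 0 w s'' n'' ->
  @oca_run _ lex_oca s i (nseq i (Some la) ++ w) s'' n''.
Proof.
move=> tr run; elim: i => //= i IH.
apply: (@oca_run_move _ lex_oca s i.+1 (Some (Some la)) s i ord0) => //=.
by rewrite addn0.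
Qed.

Lemma lex_order_one_counter :
  exists lt : G -> G -> Prop, left_order lt /\ C_left_order one_counter lt.
Proof.
apply: (@cone_C_left_order _ _ cletter_val one_counter lex_pos (oca_accepts lex_oca)).
- exact: lex_pos1.
- exact: lex_posM.
- exact: lex_pos_total.
- by exists lex_oca.
- apply: (words_generate gen);
    [exists [:: None]|exists [:: Some lb]|exists [:: Some lA; None]|exists [:: Some lB]];
    rewrite /= ?gmulg1 //.
  by rewrite ginvM -gmulA gmulVg gmulg1.
- exact: lex_oca_sound.
move=> g g0; have [i [z e]] := acR ac g.
have [|z' e'] := @powq_int q (Z.of_nat i); first lia.
(* The word a^(-2i) b^(z'z) a^(2i) a^(m g), where z' z = q^(2i) r g. *)
exists (map Some (nseq i lA ++ b_power (z' * z) ++ nseq i la) ++ nseq (Z.to_nat (m g)) None).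
split; last first.
  have evS v : eval_word cletter_val (map Some v) = eval_word (letter_val (gmul a a) b) v.
    by elim: v => //= x v ->.
  have ra2 : r (gmul a a) = 0%R by rewrite !coordE; ring.
  have ra2' : r (ginv (gmul a a)) = 0%R by rewrite !coordE; ring.
  rewrite eval_word_cat evS !eval_word_cat eval_b_power !eval_word_nseq.
  apply: (acI ac); first by rewrite /= !coordE; case: g0; lia.
  rewrite /= !rM (nseq_a _ ra2) (nseq_a _ ra2') (nseq_a _ (acRa ac)) (nseq_b _ (acMb ac)).
  rewrite !coordE mult_IZR -e -e' Rmult_0_r Rplus_0_l !Rplus_0_r Rmult_1_r.
  rewrite -!Rmult_assoc -!powqD //.
  have -> : (Z.of_nat i * - (1 + 1) + Z.of_nat i + Z.of_nat i = 0)%Z by lia.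
  by rewrite /=; ring.
rewrite !map_cat !map_nseq -!catA /=.
set y := Some (if _ then _ else _); set j := Z.abs_nat _.
have fin n : @oca_run _ lex_oca lB 0 (nseq n None) lB 0.
  by rewrite -(cats0 (nseq _ _)); apply: lex_run_keeps; [case|constructor].
exists lB, 0; split=> //; apply: lex_run_push; rewrite add0n.
(* If m g > 0, the run takes the silent move to [lb], where the exponent of b may have any sign. If
   m g = 0, that exponent is positive and the run goes through [lA]. *)
case: g0 => [mg|[mg rg]].
  apply: (@lex_run_keep la lb None); first by case.
  apply: lex_run_keeps; first by rewrite /y; case: ifP => _; case.
  apply: lex_run_pop => //.
  have -> : Z.to_nat (m g) = (Z.to_nat (m g)).-1.+1 by lia.
  exact: (@oca_run_move _ lex_oca lb 0 (Some None) lB 0 ord0 _ _ _ _ _ (fin _)).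
have z0 : (0 < z' * z)%Z.
  apply: lt_IZR; rewrite mult_IZR -e -e' -Rmult_assoc.
  apply: Rmult_lt_0_compat => //; apply: Rsqr_pos_lt; apply: powerRZ_NOR; exact: IZR_nz.
have -> : y = Some lb by rewrite /y; case: Z.ltb_spec => //; lia.
have -> : j = j.-1.+1 by lia.
apply: (@lex_run_keep la lA (Some (Some lb))); first by case.
apply: lex_run_keeps; first by case.
apply: lex_run_pop => //.
rewrite mg /=.
by apply: (@oca_run_move _ lex_oca lA 0 None lB 0 ord0) => //; constructor.
Qed.

End Constructions.

Theorem theorem3p14 (q : Z) (G : group) (a b : G)
    (HBS : BS_presentation q a b) :
  (exists lt : G -> G -> Prop, left_order lt /\ C_left_order one_counter lt) /\
  ((exists lt : G -> G -> Prop, left_order lt /\ C_left_order regular lt)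
     <-> (-1 <= q)%Z) /\
  ((2 <= q)%Z ->
   forall lt : G -> G -> Prop, left_order lt -> C_left_order regular lt ->
   forall rho : G -> R -> R,
     action_on_R rho ->
     (forall x : R, rho a x = Rmult (IZR q) x) ->
     (forall x : R, rho b x = Rplus x 1%R) ->
     induced_by_action rho lt).
Proof.
have [gen _ _] := HBS.
have [q0|q0] := Z.eq_dec q 0.
  have HBS0 : BS_presentation 0 a b by rewrite -q0.
  have reg := BS0_regular HBS0.
  split; last by split; [split=> // _; lia|lia].
  have [lt [O [X [pi [L [regL genL LP]]]]]] := reg; exists lt; split=> //.
  by exists X, pi, L; split=> //; apply: regular_one_counter.
have [m [r ac]] := BS_affine_coords HBS q0.
split; first exact: lex_order_one_counter q0 gen ac.
split; last by move=> q2 lt O reg rho; apply: (regular_induced q2 gen ac).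
split=> [[lt [O reg]]|q1].
  apply: Znot_gt_le => q2; apply: (level_one_not_regular q0 ac _ O _ reg); first lia.
  by apply: (neg_level_one_sign ac _ O); lia.
have [q2|q2] := Z_le_gt_dec 2 q; first exact: expanding_regular q0 gen ac q2.
by apply: (unit_slope_regular q0 gen ac); lia.
Qed.
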